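(* There exist adversarial Markov chains (in the sense of the context) whose state space $\mathcal{X}$ is a countable subset of $\mathbf{R}^2$ with the Euclidean metric $\eta(x,y)=|y-x|$, which fail to be bounded in probability, i.e. for which $$\lim_{L\to\infty}\sup_{n\in\mathbf{N}}\mathbf{P}\bigl(\eta(X_n,\mathbf{0})>L\mid X_0=x_0\bigr)=0$$ does not hold, even under the strong continuity condition that $\mathcal{X}$ is closed and $$\forall x\in\mathcal{X},\ \forall\epsilon>0,\ \exists\delta>0\ \text{ such that }\ \|P(y,\cdot)-P(x,\cdot)\|<\epsilon\ \text{ whenever } \eta(x,y)<\delta .$$ That is, there exists such an example with $\mathcal{X}$ closed in $\mathbf{R}^2$ and satisfying this continuity condition.
   Context: Norm: $\|\mu-\nu\|=\sup_{A\in\mathcal{F}}|\mu(A)-\nu(A)|$ for probability measures $\mu,\nu$. Adversarial Markov chain: $\mathcal{X}$ is a nonempty state space with a metric $\eta$, its Borel $\sigma$-algebra $\mathcal{F}$, and a specified origin point $\mathbf{0}\in\mathcal{X}$. $P$ is the transition kernel of a time-homogeneous Markov chain on $\mathcal{X}$ which is Harris ergodic with stationary probability distribution $\pi$: $\lim_{n\to\infty}\|P^n(x,\cdot)-\pi\|=0$ for every $x\in\mathcal{X}$. There is a constant $D<\infty$ with $P(x,\{y\in\mathcal{X}:\eta(x,y)\le D\})=1$ for all $x\in\mathcal{X}$. $K\in\mathcal{F}$ is a fixed bounded nonempty subset; for $r>0$, $K_r$ is the set of all states within distance $r$ of $K$. The adversarial Markov chain is a stochastic process $\{X_n\}_{n\ge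 0}$ with $X_0=x_0$ for a specific $x_0\in K$ such that: (i) whenever $X_n\notin K$, $\mathbf{P}(X_{n+1}\in A\mid X_0,\dots,X_n)=P(X_n,A)$ for all $A\in\mathcal{F}$; (ii) when $X_n\in K$ it may move arbitrarily according to an adversary, possibly depending on $n$ and on the history $X_0,\dots,X_n$ in a nonanticipatory manner, subject only to measurability (the conditional probabilities are well defined) and to the restriction that it cannot move more than a distance $D$ at each iteration, or more specifically that from $K$ it can only move to points of $K_D$. *)

(* Defs.v *)
From HB Require Import structures.
From mathcomp Require Import all_boot all_order all_algebra.
From mathcomp Require Import all_classical all_reals all_analysis.
From mathcomp Require Import measurable_realfun.
From mathcomp Require Import ring lra.
Set Implicit Arguments.
Unset Strict Implicit.
Unset Printing Implicit Defensive.
Import Order.TTheory GRing.Theory Num.Theory.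
Import numFieldNormedType.Exports.
Local Open Scope classical_set_scope.
Local Open Scope ring_scope.

(* The origin of a state space is the distinguished element [point]. *)
#[short(type="pmetricType")]
HB.structure Definition PointedMetric (R : numDomainType) :=
  {M of PseudoPointedMetric R M & Metric R M}.

Definition borel (R : realType) (S : pmetricType R) :=
  g_sigma_algebraType (@open S).

HB.instance Definition _ (R : realType) (S : pmetricType R) :=
  Measurable.on (borel S).

(** The Euclidean plane. The product [R * R] itself carries the sup distance,
    hence the alias. *)

Definition plane (R : realType) : Type := (R * R)%type.

Section plane_metric.
Context {R : realType}.
Implicit Types x y z : plane R.

Definition plane_dist x y : R :=
  Num.sqrt ((y.1 - x.1) ^+ 2 + (y.2 - x.2) ^+ 2).

Lemma plane_distxx x : plane_dist x x = 0.
Proof. by rewrite /plane_dist !subrr expr0n /= addr0 sqrtr0. Qed.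

Lemma plane_dist_positivity x y : plane_dist x y = 0 -> x = y.
Proof.
move=> /eqP; rewrite sqrtr_eq0 => h.
have h1 : (y.1 - x.1) ^+ 2 = 0.
  apply/eqP; rewrite eq_le sqr_ge0 andbT (le_trans _ h)//.
  by rewrite lerDl sqr_ge0.
have h2 : (y.2 - x.2) ^+ 2 = 0.
  apply/eqP; rewrite eq_le sqr_ge0 andbT (le_trans _ h)//.
  by rewrite lerDr sqr_ge0.
move: h1 h2 => /eqP + /eqP; rewrite !sqrf_eq0 !subr_eq0.
by case: x y {h} => [x1 x2] [y1 y2]/= /eqP -> /eqP ->.
Qed.

Lemma plane_dist_sym x y : plane_dist x y = plane_dist y x.
Proof. by rewrite /plane_dist; congr Num.sqrt; ring. Qed.

Lemma plane_dist_triangle y x z :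
  plane_dist x z <= plane_dist x y + plane_dist y z.
Proof.
have dE u v : plane_dist u v ^+ 2 = (v.1 - u.1) ^+ 2 + (v.2 - u.2) ^+ 2.
  by rewrite /plane_dist sqr_sqrtr// addr_ge0// sqr_ge0.
have d0 u v : 0 <= plane_dist u v by exact: sqrtr_ge0.
rewrite -ler_sqr ?nnegrE ?addr_ge0// sqrrD !dE.
set a := y.1 - x.1; set b := y.2 - x.2.
set c := z.1 - y.1; set e := z.2 - y.2.
have -> : z.1 - x.1 = a + c by rewrite /a /c; ring.
have -> : z.2 - x.2 = b + e by rewrite /b /e; ring.
suff : a * c + b * e <= plane_dist x y * plane_dist y z by lra.
rewrite (le_trans (ler_norm _))// -ler_sqr ?nnegrE ?mulr_ge0//.
rewrite exprMn !dE -/a -/b -/c -/e real_normK ?num_real// -subr_ge0.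
have -> : (a ^+ 2 + b ^+ 2) * (c ^+ 2 + e ^+ 2) - (a * c + b * e) ^+ 2 =
          (a * e - b * c) ^+ 2 by ring.
exact: sqr_ge0.
Qed.

HB.instance Definition _ := Choice.copy (plane R) (R * R)%type.
HB.instance Definition _ := @isMetric.Build R (plane R) plane_dist
  plane_distxx plane_dist_positivity plane_dist_sym plane_dist_triangle.

End plane_metric.

(* The library equips [set_type A] with the initial topology, but not with a
   distance or an origin. *)
Definition metric_subspace (R : realType) (M : metricType R) (A : set M)
  (o : A) : Type := A.

Section subspace.
Context {R : realType} {M : metricType R} (A : set M) (o : A).

HB.instance Definition _ := Choice.copy (metric_subspace o) (set_type A).

Let sdist (x y : metric_subspace o) : R := mdist (\val (x : A)) (\val (y : A)).

Let sdistxx x : sdist x x = 0.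
Proof. exact: mdistxx. Qed.

Let sdist_positivity x y : sdist x y = 0 -> x = y.
Proof. by move=> /mdist_positivity/val_inj. Qed.

Let sdist_sym x y : sdist x y = sdist y x.
Proof. exact: metric_sym. Qed.

Let sdist_triangle y x z : sdist x z <= sdist x y + sdist y z.
Proof. exact: metric_triangle. Qed.

HB.instance Definition _ := @isMetric.Build R (metric_subspace o) sdist
  sdistxx sdist_positivity sdist_sym sdist_triangle.
HB.instance Definition _ := isPointed.Build (metric_subspace o) o.

End subspace.

Section distance_of_measures.
Local Open Scope ereal_scope.

Definition tv_norm d (T : measurableType d) (R : realType)
    (mu nu : set T -> \bar R) : \bar R :=
  ereal_sup [set `|mu A - nu A| | A in measurable].

End distance_of_measures.

Section markov_kernels.
Context {R : realType} {S : pmetricType R}.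
Local Open Scope ereal_scope.
Implicit Type P : R.-pker borel S ~> borel S.

Fixpoint kernel_pow P (n : nat) (x : borel S) (A : set (borel S)) : \bar R :=
  if n is n'.+1 then \int[P x]_y kernel_pow P n' y A else \d_x A.

Definition stationary P (pi : probability (borel S) R) :=
  forall A, measurable A -> \int[pi]_x P x A = pi A.

Definition harris_ergodic P (pi : probability (borel S) R) :=
  stationary P pi /\
  forall x : S, tv_norm (kernel_pow P n x) pi @[n --> \oo] --> 0.

Definition tv_continuous P :=
  forall (x : S) (e : R), (0 < e)%R -> exists2 delta : R, (0 < delta)%R &
    forall y : S, (mdist x y < delta)%R -> tv_norm (P y) (P x) < e%:E.

End markov_kernels.

Section conditional_probability.
Context {R : realType} {d} {Omega : measurableType d}.
Variable Pr : probability Omega R.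
Local Open Scope ereal_scope.

(* [g] is a version of the conditional probability of the event [E] given the
   sub-sigma-algebra [G]. *)
Definition cond_prob_version (G : set (set Omega)) (E : set Omega)
    (g : Omega -> \bar R) :=
  [/\ forall B : set (\bar R), measurable B -> G (g @^-1` B),
      Pr.-integrable [set: Omega] g &
      forall H, G H -> \int[Pr]_(w in H) g w = Pr (E `&` H)].

End conditional_probability.

Section adversarial_chains.
Context {R : realType} {S : pmetricType R}.
Local Open Scope ereal_scope.

Definition neighborhood (K : set S) (r : R) : set S :=
  [set x | exists2 y, K y & (mdist x y <= r)%R].

Definition metric_bounded (K : set S) :=
  exists M : R, forall x y, K x -> K y -> (mdist x y <= M)%R.

Context {d} {Omega : measurableType d}.
Variable Pr : probability Omega R.
Implicit Type X : nat -> {mfun Omega >-> borel S}.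

(* The sigma-algebra generated by [X 0], ..., [X n]. *)
Definition history X (n : nat) : set (set Omega) :=
  g_sigma_preimage (fun i : 'I_n.+1 => X i : Omega -> borel S).

Record adversarial_markov_chain (P : R.-pker borel S ~> borel S)
    (pi : probability (borel S) R) (D : R) (K : set S) (x0 : S) X : Prop := {
  amc_ergodic : harris_ergodic P pi ;
  amc_step : forall x : S, P x [set y : S | (mdist x y <= D)%R] = 1 ;
  amc_K_measurable : measurable (K : set (borel S)) ;
  amc_K_bounded : metric_bounded K ;
  amc_x0 : K x0 ;
  amc_start : forall w, X 0%N w = x0 ;
  amc_outside : forall n (A : set (borel S)), measurable A ->
    exists2 g, cond_prob_version Pr (history X n) (X n.+1 @^-1` A) g &
      {ae Pr, forall w, ~ K (X n w) -> g w = P (X n w) A} ;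
  (* Nothing else constrains the law of [X n.+1] given a history that ends in
     [K]. *)
  amc_move : forall n, {ae Pr, forall w, (mdist (X n w) (X n.+1 w) <= D)%R} ;
  amc_inside : forall n,
    {ae Pr, forall w, K (X n w) -> neighborhood K D (X n.+1 w)}
}.

(* As [X 0] is constant, [Pr] is also the probability given the start. *)
Definition bounded_in_probability X :=
  ereal_sup [set Pr [set w | (mdist (X n w : S) point > L)%R] | n in [set: nat]]
    @[L --> +oo%R] --> 0.

End adversarial_chains.

(* Main.v *)
Require Import Defs.
From HB Require Import structures.
From mathcomp Require Import all_boot all_order all_algebra.
From mathcomp Require Import all_classical all_reals all_analysis.
From mathcomp Require Import measurable_realfun.
From mathcomp Require Import ring lra zify.
Set Implicit Arguments.
Unset Strict Implicit.
Unset Printing Implicit Defensive.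
Import Order.TTheory GRing.Theory Num.Theory.
Import numFieldNormedType.Exports.
Local Open Scope classical_set_scope.
Local Open Scope ring_scope.

(** The state space is the set of the points (m, 0) for m a natural number. The
    kernel P is the simple symmetric random walk on it, absorbed at 0, and
    K = {0}. Distinct states are at distance at least 1, so the continuity
    condition holds for free; what makes the example work is that the walk,
    although absorbed almost surely from every state, needs an infinite mean
    time to come back from 1 to 0.

    P is Harris ergodic with stationary distribution the Dirac mass at 0. The
    total variation distance between P^n(m, .) and that mass is at most the
    probability that the walk from m survives up to time n
    ([walk_pow_survival]). For fixed m this probability decreases with n, and
    the limit, as a function of m, is bounded, vanishes at 0 and is harmonic
    elsewhere; it is then linear in m, hence zero ([survival_cvg0]).

    The adversary always moves from 0 to 1, so that X is the random walk
    reflected at 0. One has E(X_n^2) = n and E(X_n^4) <= 3 n^2, and the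
    second-moment method gives P(X_n^2 > n/2) >= 1/12 for every n > 0
    ([reflected_spread]): a fixed share of the mass escapes to infinity.

    The process X is built on [0, 1] with the uniform measure, its coins being
    the binary digits of the sample point. The history of X up to time n only
    depends on the first n digits, and the next digit is a fair coin given these
    ([prob_next_digit]), whence the conditional law of X_(n+1). *)

(** * Fair mixtures of two measures *)

Section mixture.
Context d (T : measurableType d) (R : realType).
Variables m1 m2 : {measure set T -> \bar R}.

Definition mixture : set T -> \bar R :=
  mscale (2^-1)%:nng (measure_add m1 m2).

HB.instance Definition _ := Measure.on mixture.

Local Open Scope ereal_scope.

Lemma mixtureE A : mixture A = 2^-1%:E * (m1 A + m2 A).
Proof. by rewrite -measure_addE. Qed.

Lemma ge0_integral_mixture (f : T -> \bar R) :
  (forall x, 0 <= f x) -> measurable_fun setT f ->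
  \int[mixture]_x f x = 2^-1%:E * (\int[m1]_x f x + \int[m2]_x f x).
Proof.
move=> f0 mf; rewrite /mixture ge0_integral_mscale//.
by rewrite ge0_integral_measure_add.
Qed.

End mixture.

(** * The half-line and the random walk on it *)

(** The next state from [m] when the coin shows [b]. The value [c] at 0 is the
    only difference between the walks: [c = 0] absorbs, [c = 1] reflects. *)
Definition step (c m : nat) (b : bool) : nat :=
  if m is m'.+1 then (if b then m'.+2 else m') else c.

Section half_line.
Variable R : realType.

Definition half_line : set (plane R) :=
  [set ((m%:R, 0) : plane R) | m in [set: nat]].

Lemma half_line_in (m : nat) : ((m%:R, 0) : plane R) \in half_line.
Proof. by rewrite inE; exists m. Qed.

Definition origin : half_line := SigSub (half_line_in 0).

Definition states : pmetricType R := metric_subspace origin.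

Definition pos (m : nat) : states := SigSub (half_line_in m).

Definition coord (s : states) : nat := Num.truncn (val (s : half_line)).1.

Lemma posK : cancel pos coord.
Proof. by move=> m; rewrite /coord/= natrK. Qed.

Lemma coordK : cancel coord pos.
Proof.
case=> x xL; have := xL; rewrite inE => -[m _ mx].
by apply/val_inj; rewrite /coord/= -mx/= natrK.
Qed.

Lemma plane_dist_line (m n : nat) :
  plane_dist ((m%:R, 0) : plane R) (n%:R, 0) = `|n%:R - m%:R|.
Proof. by rewrite /plane_dist/= subrr expr0n addr0 sqrtr_sqr. Qed.

Lemma mdist_pos (m n : nat) : mdist (pos m) (pos n) = `|n%:R - m%:R| :> R.
Proof. exact: plane_dist_line. Qed.

Lemma natr_dist_lt1 (m n : nat) : `|n%:R - m%:R| < 1 :> R -> m = n.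
Proof.
by rewrite ltr_distl ltrBlDr !natr1 !ltr_nat => /andP[? ?]; lia.
Qed.

Lemma mdist_states_lt1 (x y : states) : (mdist x y < 1 :> R) -> x = y.
Proof.
rewrite -(coordK x) -(coordK y) mdist_pos => /natr_dist_lt1 E.
by rewrite E.
Qed.

Lemma countable_half_line : countable half_line.
Proof. exact: (sub_countable (card_image_le _ _)). Qed.

(** Two points of the half-line less than 1 apart coincide, so a limit point
    has a single neighbour within 1/2, from which its distance must be 0. *)
Lemma closed_half_line : closed half_line.
Proof.
move=> x clx; have h2 : 0 < 2^-1 :> R by rewrite invr_gt0.
have [_ [[m _ <-]]] := clx _ (nbhsx_ballx x _ h2).
set a : plane R := (m%:R, 0); rewrite ballEmdist/= => xa.
have [->|xNa] := eqVneq x a; first by exists m.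
have xa0 : 0 < mdist x a by rewrite mdist_gt0.
have [_ [[n _ <-]]] := clx _ (nbhsx_ballx x _ xa0).
set b : plane R := (n%:R, 0); rewrite ballEmdist/= => xb.
suff E : m = n by move: xb; rewrite /b -E ltxx.
apply: natr_dist_lt1; rewrite -plane_dist_line -/a -/b.
have := metric_triangle a x b; rewrite (metric_sym a x).
rewrite -[mdist a b]/(plane_dist a b); lra.
Qed.

(** The states are isolated: balls of radius 1 are singletons. *)
Lemma open_states (B : set states) : open B.
Proof.
rewrite openE => x Bx; apply/nbhs_ballP; exists 1 => //= y.
by rewrite ballEmdist/= => /mdist_states_lt1 <-.
Qed.

Lemma measurable_states (B : set (borel states)) : measurable B.
Proof. apply: sub_sigma_algebra; exact: open_states. Qed.

Definition walk (c : nat) (x : borel states) : set (borel states) -> \bar R :=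
  let next b := @dirac _ (borel states) (pos (step c (coord x) b)) R in
  mixture (next false) (next true).

HB.instance Definition _ c x := Measure.on (walk c x).

Lemma walkE c x A : walk c x A =
  (2^-1 * (\1_A (pos (step c (coord x) false)) +
           \1_A (pos (step c (coord x) true))))%:E.
Proof. by rewrite /walk mixtureE EFinM EFinD. Qed.

Lemma integral_walk c x (f : borel states -> \bar R) :
  (forall y, 0 <= f y)%E ->
  (\int[walk c x]_y f y =
   2^-1%:E * (f (pos (step c (coord x) false)) +
              f (pos (step c (coord x) true))))%E.
Proof.
move=> f0.
have mf : measurable_fun setT f by move=> _ Y _; exact: measurable_states.
rewrite ge0_integral_mixture// !integral_dirac//.
by rewrite !diracT !mul1e.
Qed.

Lemma walk_setT c x : walk c x [set: borel states] = 1%E.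
Proof.
by rewrite walkE !indicE !in_setT /=; congr EFin; field.
Qed.

Definition walk_kernel c :
    borel states -> {measure set (borel states) -> \bar R} := walk c.

Lemma measurable_walk_kernel c (U : set (borel states)) :
  measurable U -> measurable_fun setT (walk_kernel c ^~ U).
Proof. by move=> _ _ Y _; exact: measurable_states. Qed.

HB.instance Definition _ c := @isKernel.Build _ _ (borel states) (borel states)
  R (walk_kernel c) (@measurable_walk_kernel c).

HB.instance Definition _ c := @Kernel_isProbability.Build _ _ (borel states)
  (borel states) R (walk_kernel c) (walk_setT c).

End half_line.

(** * The absorbed walk dies out *)

Section absorbed_walk.
Variable R : realType.

(** The probability that the absorbed walk started at [m] is not at 0 at time
    [n], computed by conditioning on the first step. *)
Fixpoint survival (n m : nat) : R :=
  if n is n'.+1 then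
    2^-1 * (survival n' (step 0 m false) + survival n' (step 0 m true))
  else (m != 0)%:R.

Lemma survivalS n m : survival n.+1 m =
  2^-1 * (survival n (step 0 m false) + survival n (step 0 m true)).
Proof. by []. Qed.

Lemma survival0 n : survival n 0 = 0.
Proof. by elim: n => [|n IH] /=; rewrite ?eqxx// IH addr0 mulr0. Qed.

Lemma survival_ge0 n m : 0 <= survival n m.
Proof. by elim: n m => [|n IH] m /=; rewrite ?ler0n// mulr_ge0// addr_ge0. Qed.

Lemma survival_le1 n m : survival n m <= 1.
Proof.
elim: n m => [|n IH] m; first by rewrite /= lern1 leq_b1.
rewrite survivalS.
by have := IH (step 0 m false); have := IH (step 0 m true); lra.
Qed.

(** The induction hypothesis passes through the averaging over the first step,
    so that only times 0 and 1 have to be compared. *)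
Lemma survival_nonincreasing m : nonincreasing_seq (survival ^~ m).
Proof.
apply/nonincreasing_seqP => n; elim: n m => [|n IH] [|m].
- by rewrite !survival0.
- exact: survival_le1.
- by rewrite !survival0.
- rewrite !(survivalS _ m.+1).
  by have := IH m; have := IH m.+2; lra.
Qed.

(** A function that is harmonic away from 0 and vanishes at 0 is linear, and 0
    is the only bounded linear function. *)
Lemma bounded_harmonic0 (l : nat -> R) : l 0%N = 0 ->
  (forall m, l m.+1 = 2^-1 * (l m + l m.+2)) ->
  (forall m, 0 <= l m <= 1) -> forall m, l m = 0.
Proof.
move=> l0 lH lb.
have lin m : l m = m%:R * l 1%N /\ l m.+1 = m.+1%:R * l 1%N.
  elim: m => [|m [IH1 IH2]]; first by rewrite l0 mul0r mul1r.
  split=> //; have := lH m; rewrite IH1 IH2 -!natr1 => H.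
  have -> : l m.+2 = 2 * ((m%:R + 1) * l 1%N) - m%:R * l 1%N.
    by rewrite H; field.
  by ring.
suff l1 : l 1%N = 0 by move=> m; rewrite (lin m).1 l1 mulr0.
have /andP[l1_ge0 _] := lb 1%N.
apply/eqP; rewrite eq_le l1_ge0 andbT leNgt; apply/negP => l1_gt0.
have := lb (Num.truncn (l 1%N)^-1).+1; rewrite (lin _).1 => /andP[_].
apply/negP; rewrite -ltNge -ltr_pdivrMr// mul1r.
exact: truncnS_gt.
Qed.

Lemma survival_cvg0 m : survival n m @[n --> \oo] --> 0.
Proof.
have cv k : cvgn (survival ^~ k).
  apply: (nonincreasing_is_cvgn (survival_nonincreasing k)).
  by exists 0 => _ [n _ <-]; exact: survival_ge0.
pose l k := limn (survival ^~ k).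
suff <- : l m = 0 by exact: cv.
apply: bounded_harmonic0 => [|k|k].
- rewrite /l (_ : survival ^~ 0%N = cst 0) ?lim_cst//.
  by apply/funext => n; rewrite survival0.
- apply/cvg_lim => //; rewrite -(cvg_shiftS (survival ^~ k.+1)).
  by apply: cvgMr; apply: cvgD; exact: cv.
- apply/andP; split.
    by apply: limr_ge => //; apply: nearW => n; exact: survival_ge0.
  by apply: limr_le => //; apply: nearW => n; exact: survival_le1.
Qed.

End absorbed_walk.

(** * Moments of the reflected walk *)

Section reflected_walk.
Variable R : realType.

(** The expectation of [phi] at the number written by [n] fair binary digits. *)
Definition mean (n : nat) (phi : nat -> R) : R :=
  (\sum_(0 <= j < 2 ^ n) phi j) / (2 ^ n)%:R.

Lemma mean0 phi : mean 0 phi = phi 0%N.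
Proof. by rewrite /mean expn0 big_nat1 divr1. Qed.

(** The numbers below [2 ^ n.+1] are the [2 i] and [2 i + 1] for [i] below
    [2 ^ n]: the last digit is a fair coin independent of the others. *)
Lemma meanS n phi :
  mean n.+1 phi = mean n (fun i => 2^-1 * (phi i.*2 + phi i.*2.+1)).
Proof.
have sum2 N : \sum_(0 <= j < N.*2) phi j =
    \sum_(0 <= i < N) (phi i.*2 + phi i.*2.+1).
  elim: N => [|N IH]; first by rewrite !big_geq.
  by rewrite doubleS !big_nat_recr//= IH addrA.
rewrite /mean expnS mul2n sum2 -mulr_sumr -mul2n natrM invfM.
by rewrite mulrCA mulrA.
Qed.

Lemma meanD n phi psi :
  mean n (fun j => phi j + psi j) = mean n phi + mean n psi.
Proof. by rewrite /mean big_split mulrDl. Qed.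

Lemma meanZ n k phi : mean n (fun j => k * phi j) = k * mean n phi.
Proof. by rewrite /mean -mulr_sumr mulrA. Qed.

Lemma mean_cst n k : mean n (fun=> k) = k.
Proof.
rewrite /mean sumr_const_nat subn0 -[k *+ _]mulr_natr.
by rewrite mulfK// pnatr_eq0 expn_eq0.
Qed.

Lemma ler_mean n phi psi : (forall j, phi j <= psi j) ->
  mean n phi <= mean n psi.
Proof.
by move=> le; rewrite ler_pM2r ?invr_gt0 ?ltr0n ?expn_gt0//; exact: ler_sum.
Qed.

(** The position at time [n] when the coins are the binary digits of [j], the
    last coin being the least significant digit. *)
Fixpoint reflected (n j : nat) : nat :=
  if n is n'.+1 then step 1 (reflected n' j./2) (odd j) else 0%N.

(** One step of the reflected walk seen through its expectation: averaging over
    the last digit applies the transition operator. *)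
Lemma mean_reflected n (phi : nat -> R) :
  mean n.+1 (phi \o reflected n.+1) =
  mean n (fun i => 2^-1 * (phi (step 1 (reflected n i) false) +
                           phi (step 1 (reflected n i) true))).
Proof.
rewrite meanS; congr mean; apply/funext => i /=.
by rewrite odd_double doubleK/= uphalf_double.
Qed.

(** The two neighbours of [m > 0] have squares of average [m ^ 2 + 1], and the
    forced move from 0 to 1 also raises the square by 1. *)
Lemma mean_reflected2 n : mean n (fun j => (reflected n j)%:R ^+ 2) = n%:R.
Proof.
elim: n => [|n IH]; first by rewrite mean0 expr0n.
rewrite (mean_reflected n (fun m => m%:R ^+ 2)).
transitivity (mean n (fun j => (reflected n j)%:R ^+ 2 + 1)).
  congr mean; apply/funext => i.
  case: (reflected n i) => [|m] /=; first by field.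
  by rewrite -!natr1; field.
by rewrite meanD mean_cst IH natr1.
Qed.

(** The same computation for fourth powers: a step adds [6 m ^ 2 + 1] on
    average, which sums up to exactly [3 n ^ 2 - 2 n]. *)
Lemma mean_reflected4 n :
  mean n (fun j => (reflected n j)%:R ^+ 4) <= 3 * n%:R ^+ 2.
Proof.
suff -> : mean n (fun j => (reflected n j)%:R ^+ 4) = 3 * n%:R ^+ 2 - 2 * n%:R.
  by rewrite gerBl mulr_ge0.
elim: n => [|n IH]; first by rewrite mean0 !expr0n/= !mulr0 subr0.
rewrite (mean_reflected n (fun m => m%:R ^+ 4)).
transitivity (mean n (fun j => (reflected n j)%:R ^+ 4 +
                (6 * (reflected n j)%:R ^+ 2 + 1))).
  congr mean; apply/funext => i.
  case: (reflected n i) => [|m] /=; first by field.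
  by rewrite -!natr1; field.
by rewrite meanD meanD meanZ mean_reflected2 mean_cst IH -[n.+1%:R]natr1; ring.
Qed.

(** Second-moment method for [t = X_n ^ 2 / n], whose mean is 1 and whose second
    moment is at most 3. The indicator of [t > 1/2] is at least
    [t / 3 - t ^ 2 / 36 - 1 / 6], which has mean at least
    [1 / 3 - 1 / 12 - 1 / 6 = 1 / 12]. *)
Lemma reflected_spread n : (0 < n)%N ->
  12^-1 <= mean n (fun j => (n%:R < 2 * (reflected n j)%:R ^+ 2 :> R)%:R).
Proof.
move=> n0; have N0 : 0 < n%:R :> R by rewrite ltr0n.
have key j : (3 * n%:R)^-1 * (reflected n j)%:R ^+ 2 +
    (- (36 * n%:R ^+ 2)^-1 * (reflected n j)%:R ^+ 4 + - 6^-1) <=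
    (n%:R < 2 * (reflected n j)%:R ^+ 2 :> R)%:R :> R.
  move: (reflected n j)%:R => x; rewrite (exprM x 2 2); move: (x ^+ 2) => y.
  set t := y / n%:R.
  have yt : y = t * n%:R by rewrite /t divfK// gt_eqF.
  have -> : (3 * n%:R)^-1 * y + (- (36 * n%:R ^+ 2)^-1 * y ^+ 2 + - 6^-1) =
      t / 3 - t ^+ 2 / 36 - 6^-1 by rewrite yt; field; rewrite gt_eqF.
  have -> : (n%:R < 2 * y) = (1 < 2 * t).
    by rewrite yt mulrA -ltr_pdivrMr// divff// gt_eqF.
  case: ltP => /= ht.
    have : 0 <= (t - 6) ^+ 2 by exact: sqr_ge0.
    nra.
  have : 0 <= t ^+ 2 by exact: sqr_ge0.
  nra.
apply: le_trans (ler_mean n key).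
rewrite meanD meanD !meanZ mean_cst mean_reflected2.
have : (36 * n%:R ^+ 2)^-1 * mean n (fun j => (reflected n j)%:R ^+ 4) <= 12^-1.
  rewrite mulrC ler_pdivrMr ?mulr_gt0 ?exprn_gt0//.
  by apply: le_trans (mean_reflected4 n) _; lra.
have -> : (3 * n%:R)^-1 * n%:R = 3^-1 :> R by field; rewrite gt_eqF.
lra.
Qed.

End reflected_walk.

(** * Binary digits as fair coins *)

Section dyadic_digits.
Variable R : realType.

Definition samples : measurableType _ := measurableTypeR R.
Definition prob : probability samples R := uniform_prob (@ltr01 R).

(** The first [n] binary digits of [u] in [0, 1), read as a number. *)
Definition digits (n : nat) (u : R) : nat := Num.truncn (2 ^+ n * u).

Lemma half_digits n u : (digits n.+1 u)./2 = digits n u.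
Proof.
rewrite /digits exprS -mulrA; set x := 2 ^+ n * u.
have [x0|x0] := leP 0 x; last first.
  by rewrite !truncn_floor !leNgt pmulr_rlt0// x0.
apply/esym/truncn_def; have := truncn_itv (mulr_ge0 (ler0n R 2) x0).
set k := Num.truncn _; rewrite -[X in X%:R <= _](odd_double_half k).
rewrite -[X in _ < X.+1%:R](odd_double_half k) -!natr1 !natrD -mul2n natrM.
by case: (odd k) => /= /andP[? ?]; apply/andP; split; lra.
Qed.

Lemma measurable_digits n (B : set nat) :
  measurable (digits n @^-1` B : set samples).
Proof.
have mge k : measurable ([set u | (k <= digits n u)%N] : set samples).
  case: k => [|k]; first by rewrite (_ : [set _ | _] = setT)//; apply/seteqP.
  rewrite (_ : [set _ | _] = `[k.+1%:R / 2 ^+ n, +oo[%classic)//.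
  apply/seteqP; split=> u; rewrite /= in_itv/= andbT /digits truncn_gt_nat;
    by rewrite ler_pdivrMr ?exprn_gt0// mulrC.
rewrite -(image_id B) -bigcup_imset1 preimage_bigcup.
apply: bigcup_measurable => j _.
rewrite (_ : _ @^-1` _ =
  [set u | (j <= digits n u)%N] `\` [set u | (j.+1 <= digits n u)%N]).
  exact: measurableD.
apply/seteqP; split=> u /=; first by move=> ->; rewrite ltnn leqnn.
move=> [? /negP]; rewrite -leqNgt => ?.
by apply/eqP; rewrite eqn_leq; apply/andP.
Qed.

Lemma probE V : measurable V -> prob V = lebesgue_measure (V `&` `[0%R, 1%R]).
Proof.
move=> mV; rewrite /prob/= /uniform_prob integral_uniform_pdf.
rewrite (eq_integral (fun=> 1%E)) ?integral_cst ?mul1e//.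
  exact: measurableI.
move=> u; rewrite inE/= in_itv/= => -[_ u01].
by rewrite /uniform_pdf u01 subr0 invr1.
Qed.

Lemma prob_cell n j : (j < 2 ^ n)%N ->
  prob (digits n @^-1` [set j]) = ((2 ^ n)%:R^-1)%:E.
Proof.
move=> jn; have p0 : 0 < 2 ^+ n :> R by rewrite exprn_gt0.
have jn' : j.+1%:R / 2 ^+ n <= 1 :> R.
  by rewrite ler_pdivrMr// mul1r -natrX ler_nat.
rewrite probE; last exact: measurable_digits.
rewrite (_ : _ `&` _ = `[j%:R / 2 ^+ n, j.+1%:R / 2 ^+ n[%classic).
  rewrite lebesgue_measure_itv/= lte_fin ltr_pM2r ?invr_gt0// ltr_nat ltnSn.
  by rewrite -EFinD -mulrBl -natr1 addrAC subrr add0r mul1r natrX.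
apply/seteqP; split=> u; rewrite /= !in_itv/= ler_pdivrMr// ltr_pdivlMr//.
  move=> [<- /andP[u0 _]]; rewrite /digits mulrC truncn_itv// mulr_ge0//.
move=> /[dup] ju /andP[ju1 ju2].
have u0 : 0 <= u by rewrite -(pmulr_lge0 _ p0) (le_trans _ ju1).
split; first by rewrite /digits mulrC; exact: truncn_def.
rewrite u0 (le_trans _ jn')// ltW//.
by rewrite ltr_pdivlMr.
Qed.

(** The first [n] digits of a uniform point are uniformly distributed below
    [2 ^ n]; the points outside of these dyadic cells have total mass 0. *)
Lemma prob_digits n (B : set nat) :
  prob (digits n @^-1` B) = (mean n (\1_B : nat -> R))%:E.
Proof.
have mD := @measurable_digits n.
have part (C : set nat) m : (m <= 2 ^ n)%N ->
    prob (digits n @^-1` (C `&` [set j | (j < m)%N])) =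
    ((\sum_(0 <= j < m) \1_C j) / (2 ^ n)%:R)%:E.
  elim: m => [_|m IH mn].
    rewrite big_geq// mul0r (_ : _ `&` _ = set0) ?preimage_set0 ?measure0//.
    by apply/seteqP; split=> j [].
  rewrite (_ : _ `&` _ = (C `&` [set j | (j < m)%N]) `|` (C `&` [set m])).
    rewrite preimage_setU measureU//; last first.
      rewrite -preimage_setI (_ : _ `&` _ = set0) ?preimage_set0//.
      by apply/seteqP; split=> j //= [[_ jm] [_ jE]]; move: jm; rewrite jE ltnn.
    rewrite big_nat_recr//= mulrDl EFinD IH 1?ltnW//; congr (_ + _)%E.
    rewrite indicE; have [/set_mem Cm|/negP Cm] := boolP (m \in C).
      rewrite mul1r setIidr ?prob_cell//.
      by move=> _ ->.
    rewrite mul0r (_ : _ `&` _ = set0) ?preimage_set0 ?measure0//.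
    by apply/seteqP; split=> j //= [Cj jE]; apply: Cm; rewrite inE -jE.
  apply/seteqP; split=> j /=; last first.
    by move=> [[Cj jm]|[Cj jE]]; split=> //; [rewrite ltnS ltnW|rewrite jE].
  by move=> [Cj]; rewrite ltnS leq_eqVlt => /orP[/eqP jE|jm]; [right|left].
pose T := [set j | (j < 2 ^ n)%N].
have PT : prob (digits n @^-1` T) = 1%E.
  rewrite -(setTI T) part// -/(mean n _).
  by rewrite (_ : \1_[set: nat] = fun=> 1) ?mean_cst// indicT.
rewrite -(part B _ (leqnn _)) preimage_setI.
rewrite (measureDI prob (mD B) (mD T)) [X in (X + _)%E](_ : _ = 0%E) ?add0e//.
have mTC := measurableC (mD T).
apply/eqP; rewrite -measure_le0.
have -> : 0%E = prob (~` (digits n @^-1` T)).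
  by rewrite probability_setC// PT subee.
by apply: le_measure; rewrite ?inE//; exact: measurableD.
Qed.

Lemma prob_next_digit n (B : set nat) b :
  prob (digits n @^-1` B `&` [set u | odd (digits n.+1 u) = b]) =
  (2^-1%:E * prob (digits n @^-1` B))%E.
Proof.
rewrite (_ : _ `&` _ =
  digits n.+1 @^-1` [set j | B j./2 /\ odd j = b]); last first.
  by apply/seteqP; split=> u; rewrite /= half_digits.
rewrite !prob_digits meanS -EFinM -meanZ; congr (mean n _)%:E.
apply/funext => i; congr (_ * _); rewrite !indicE.
have E j c : odd j = c -> j./2 = i ->
    (j \in [set j | B j./2 /\ odd j = b]) = (i \in B) && (c == b).
  move=> jc ji; apply/idP/andP; rewrite !inE/= ji jc.
    by move=> [Bi ->].
  by move=> [Bi /eqP].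
rewrite (E _ false) ?odd_double ?doubleK// (E _ true)//=; last 2 first.
- by rewrite odd_double.
- by rewrite uphalf_double.
by case: b {E}; rewrite ?(andbT, andbF) ?addr0 ?add0r.
Qed.

End dyadic_digits.

(** * The adversarial chain *)

Section chain.
Variable R : realType.
Local Notation S := (states R).

(** The reflected walk driven by the digits of the sample point. *)
Definition chain (n : nat) (u : samples R) : borel S :=
  pos R (reflected n (digits n u)).

Lemma measurable_chain n : measurable_fun setT (chain n).
Proof.
move=> _ A _; rewrite setTI.
exact: (@measurable_digits R n [set j | A (pos R (reflected n j))]).
Qed.

HB.instance Definition _ n :=
  isMeasurableFun.Build _ _ (samples R) (borel S) (chain n)
    (measurable_chain n).

Definition chain_mfun (n : nat) : {mfun samples R >-> borel S} := chain n.

Lemma chainS n u :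
  chain n.+1 u =
  pos R (step 1 (reflected n (digits n u)) (odd (digits n.+1 u))).
Proof. by rewrite /chain /= half_digits. Qed.

Lemma digits_prefix n k (u : R) : digits n u = iter k half (digits (k + n) u).
Proof. by elim: k => [|k IH] //; rewrite iterSr addSn half_digits. Qed.

(** Earlier digits are obtained from the first [n] ones by halving, so the first
    [n] digits determine the whole history. *)
Lemma history_digits n (H : set (samples R)) : history chain_mfun n H ->
  exists B : set nat, H = digits n @^-1` B.
Proof.
apply: (@smallest_sub _ (sigma_algebra setT) _
  [set H | exists B : set nat, H = digits n @^-1` B]).
  split; first by exists set0.
    by move=> _ [B ->]; exists (~` B); rewrite setTD.
  move=> F FB; exists (\bigcup_k sval (cid (FB k))); rewrite preimage_bigcup.
  by apply: eq_bigcupr => k _; case: cid.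
rewrite -(bigcup_mkord _
  (fun i => preimage_set_system setT (chain i) measurable)).
move=> _ [i /= ilen [A _ <-]].
exists [set j | A (pos R (reflected i (iter (n - i) half j)))].
rewrite setTI; apply/funext => u.
by rewrite /preimage/= /chain (digits_prefix i (n - i)) subnK.
Qed.

Lemma history_chain n (A : set (borel S)) :
  history chain_mfun n (chain n @^-1` A).
Proof.
apply: sub_sigma_algebra.
rewrite -(bigcup_mkord _
  (fun i => preimage_set_system setT (chain i) measurable)).
exists n => //=; exists A; first exact: measurable_states.
by rewrite setTI.
Qed.

Lemma coord_chain n u : coord (chain n u) = reflected n (digits n u).
Proof. exact: posK. Qed.

(** An event of the history is an event about the first [n] digits. On it the
    two possible moves are decided by the next digit, which is independent of
    the event, so integrating the fair mixture of the two outcomes counts each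
    with its probability. *)
Lemma cond_prob_chain n (A : set (borel S)) :
  cond_prob_version (prob R) (history chain_mfun n) (chain n.+1 @^-1` A)
    (fun u => walk 1 (chain n u) A).
Proof.
have mg : measurable_fun setT (fun u : samples R => walk 1 (chain n u) A).
  move=> _ Y _; rewrite setTI.
  exact: (@measurable_digits R n
    [set j | Y (walk 1 (pos R (reflected n j)) A)]).
split.
- move=> Y _.
  rewrite (_ : _ @^-1` Y = chain n @^-1` [set x | Y (walk 1 x A)])//.
  exact: history_chain.
- apply: (@le_integrable _ _ _ (prob R) _ _ _ (cst 1%E)) => //.
    move=> u _; rewrite /= normr1 gee0_abs// -(walk_setT 1 (chain n u)).
    by apply: le_measure; rewrite ?inE//; exact: measurable_states.
  exact: (finite_measure_integrable_cst (prob R) 1).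
- move=> H /history_digits[B ->].
  pose next b := [set j | A (pos R (step 1 (reflected n j) b))].
  have mD := @measurable_digits R n.
  transitivity (\int[prob R]_(w in digits n @^-1` B) (2^-1%:E *
      ((\1_(digits n @^-1` next false) w)%:E +
       (\1_(digits n @^-1` next true) w)%:E)))%E.
    apply: eq_integral => u _; rewrite walkE coord_chain EFinM EFinD.
    by rewrite !indicE.
  have mi C : measurable_fun (digits n @^-1` B : set (samples R))
      (fun w => (\1_(digits n @^-1` C) w)%:E : \bar R).
    by apply/measurable_EFinP; exact: measurable_indic.
  rewrite ge0_integralZl//=; first last.
  - by move=> *; rewrite adde_ge0.
  - exact: emeasurable_funD.
  rewrite ge0_integralD// !integral_indic//.
  rewrite ge0_muleDr// -!preimage_setI.
  rewrite -(prob_next_digit R n (_ `&` B) false).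
  rewrite -(prob_next_digit R n (_ `&` B) true).
  (* The events that the next digit is 0 or 1 split the right-hand side. *)
  rewrite -measureU.
  + congr (prob R _).
    apply/seteqP; split=> u; rewrite /= -/(chain n.+1 u) chainS.
      by move=> [[[? ?] ->]|[[? ?] ->]].
    by move=> [Au Bu]; case: odd Au => Au; [right|left].
  + apply: measurableI => //.
    exact: (@measurable_digits R n.+1 [set j | odd j = false]).
  + apply: measurableI => //.
    exact: (@measurable_digits R n.+1 [set j | odd j = true]).
  + by apply/seteqP; split=> u //= [[_ ->] []].
Qed.

(** The probability that the absorbed walk from [m] is in [A] at time [n]; a
    real-valued form of [kernel_pow] of the walk. *)
Fixpoint walk_pow (n m : nat) (A : set (borel S)) : R :=
  if n is n'.+1 then
    2^-1 * (walk_pow n' (step 0 m false) A + walk_pow n' (step 0 m true) A)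
  else \1_A (pos R m).

Lemma walk_pow_ge0 n m A : 0 <= walk_pow n m A.
Proof.
by elim: n m => [|n IH] m /=; rewrite ?indicE ?ler0n// mulr_ge0// addr_ge0.
Qed.

Lemma kernel_pow_walk n (x : borel S) A :
  kernel_pow (walk_kernel 0) n x A = (walk_pow n (coord x) A)%:E.
Proof.
elim: n x => [|n IH] x; first by rewrite /= diracE coordK indicE.
rewrite /= (eq_integral _ _ (fun y _ => IH y)).
rewrite integral_walk; last by move=> y; rewrite lee_fin walk_pow_ge0.
by rewrite !posK.
Qed.

(** Once absorbed the walk sits at 0, so the two laws only differ on the event
    of survival. *)
Lemma walk_pow_survival n m A :
  `|walk_pow n m A - \1_A (pos R 0)| <= survival R n m.
Proof.
elim: n m => [|n IH] m.
  case: m => [|m] /=; first by rewrite subrr normr0.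
  by rewrite !indicE; case: (_ \in A); case: (_ \in A);
    rewrite /= ?subrr ?subr0 ?sub0r ?normrN ?normr0 ?normr1.
rewrite survivalS /=; move: (IH (step 0 m false)) (IH (step 0 m true)).
move: (walk_pow _ _ _) (walk_pow _ _ _) (survival _ _ _) (survival _ _ _).
move=> a b c d; rewrite !ler_norml => /andP[? ?] /andP[? ?].
by apply/andP; split; lra.
Qed.

Lemma harris_ergodic_walk :
  harris_ergodic (walk_kernel 0) (@dirac _ (borel S) (pos R 0) R).
Proof.
split.
  move=> A _; rewrite integral_dirac//.
    rewrite diracT mul1e [LHS](walkE 0) posK /= diracE indicE; congr EFin.
    by field.
  exact: measurable_walk_kernel (measurable_states A).
move=> x; apply: (@squeeze_cvge _ _ _ _ (cst 0%E) _
  (fun n => (survival R n (coord x))%:E)).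
- near=> n; apply/andP; split.
    exact: le_trans (abse_ge0 _) (ereal_sup_ubound (imageP _ measurable0)).
  apply: ge_ereal_sup => _ [A _ <-].
  rewrite kernel_pow_walk -[X in (_ - X)%E]/((\1_A (pos R 0))%:E).
  rewrite -EFinB lee_fin.
  exact: walk_pow_survival.
- exact: cvg_cst.
- by apply/fine_cvgP; split; [exact: nearW|exact: survival_cvg0].
Unshelve. all: by end_near.
Qed.

Lemma tv_continuous_walk : tv_continuous (@walk_kernel R 0).
Proof.
move=> x e e0; exists 1 => // y /mdist_states_lt1 ->.
apply: le_lt_trans (_ : 0%E < _)%E; last by rewrite lte_fin.
apply: ge_ereal_sup => _ [A _ <-].
by rewrite subee ?abse0// [X in X \is a _](walkE 0).
Qed.

(** Whatever [L] is, at a time [n > 2 L ^ 2] the event [X_n ^ 2 > n / 2] implies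
    that the chain is farther than [L]. *)
Lemma unbounded_chain : ~ bounded_in_probability (prob R) chain_mfun.
Proof.
move=> bd; have : nbhs 0%E [set x : \bar R | (x < 12^-1%:E)%E].
  by apply: open_ereal_lt'; rewrite lte_fin invr_gt0.
move=> /bd/(@filter_ex _ (pinfty_nbhs R))[L] /=; apply/negP; rewrite -leNgt.
pose n := (Num.truncn (2 * L ^+ 2)).+1.
have n0 : (0 < n)%N by [].
have nL : 2 * L ^+ 2 < n%:R by exact: truncnS_gt.
apply: (le_trans _ (ereal_sup_ubound (imageT _ n))).
apply: (@le_trans _ _ (prob R (digits n @^-1`
    [set j | n%:R < 2 * (reflected n j)%:R ^+ 2 :> R]))).
  rewrite prob_digits lee_fin; apply: le_trans (reflected_spread R n0) _.
  apply: ler_mean => j; rewrite indicE; case: (ltP n%:R) => h //.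
  by rewrite mem_set.
apply: le_measure; rewrite ?inE.
- exact: measurable_digits.
- exact: (@measurable_digits R n
    [set j | mdist (pos R (reflected n j)) (pos R 0) > L]).
move=> u /= pu.
rewrite -[point]/(pos R 0) /chain_mfun/= metric_sym mdist_pos subr0 normr_nat.
rewrite ltNge; apply/negP => pL.
have : (reflected n (digits n u))%:R ^+ 2 <= L ^+ 2.
  by rewrite ler_sqr ?nnegrE ?(le_trans _ pL).
lra.
Qed.

Lemma adversarial_chain : adversarial_markov_chain (prob R) (walk_kernel 0)
  (@dirac _ (borel S) (pos R 0) R) 1 [set pos R 0] (pos R 0) chain_mfun.
Proof.
have dist_step c m b : (c <= 1)%N ->
    mdist (pos R m) (pos R (step c m b)) <= 1 :> R.
  move=> c1; rewrite mdist_pos.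
  case: m => [|m] /=; first by rewrite subr0 normr_nat lern1.
  by case: b; rewrite -!natr1 ler_norml; apply/andP; split; lra.
split.
- exact: harris_ergodic_walk.
- move=> x; rewrite [LHS](walkE 0) !indicE !mem_set /=.
    by congr EFin; field.
    by rewrite -{1}(coordK x); exact: dist_step.
  by rewrite -{1}(coordK x); exact: dist_step.
- exact: measurable_states.
- by exists 0 => x y -> ->; rewrite mdistxx.
- by [].
- by [].
- move=> n A _; exists (fun u => walk 1 (chain n u) A).
    exact: cond_prob_chain.
  apply: aeW => u /= nK; rewrite !walkE coord_chain.
  case p0: (reflected n (digits n u)) => [|//].
  by exfalso; apply: nK; rewrite /chain p0.
- move=> n; apply: aeW => u; rewrite /chain_mfun/= chainS; exact: dist_step.
- move=> n; apply: aeW => u /= K0; exists (pos R 0) => //.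
  by rewrite metric_sym chainS -K0; exact: dist_step.
Qed.

End chain.

Theorem proposition3 (R : realType) :
  exists (A : set (plane R)) (o : A),
  let S : pmetricType R := metric_subspace o in
  exists (P : R.-pker borel S ~> borel S) (pi : probability (borel S) R)
    (D : R) (K : set S) (x0 : S)
    (d : measure_display) (Omega : measurableType d) (Pr : probability Omega R)
    (X : nat -> {mfun Omega >-> borel S}),
  [/\ countable A,
      closed A,
      adversarial_markov_chain Pr P pi D K x0 X,
      tv_continuous P &
      ~ bounded_in_probability Pr X].
Proof.
exists (@half_line R), (origin R) => S.
exists (@walk_kernel R 0), (@dirac _ (borel (states R)) (pos R 0) R), 1.
exists [set pos R 0], (pos R 0), _, (samples R), (prob R), (@chain_mfun R).
split.
- exact: countable_half_line.
- exact: closed_half_line.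
- exact: adversarial_chain.
- exact: tv_continuous_walk.
- exact: unbounded_chain.
Qed.
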